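(* Let $\mathcal{I}$ be an analytic P-ideal on $\omega$. Then the following are equivalent: (A1) $\mathcal{I}$ is a generalized density ideal; (A2) every lscsm $\varphi$ such that $\mathcal{I}=\mathrm{Exh}(\varphi)$ satisfies condition $\mathrm{D}_{\mathrm{strong}}$; (A3) every lscsm $\varphi$ such that $\mathcal{I}=\mathrm{Exh}(\varphi)$ satisfies condition $\mathrm{D}_{\mathrm{weak}}$; (A4) $\mathcal{I}=\mathrm{Exh}(\varphi)$ for some lscsm $\varphi$ satisfying condition $\mathrm{D}_{\mathrm{strong}}$; (A5) $\mathcal{I}=\mathrm{Exh}(\varphi)$ for some lscsm $\varphi$ satisfying condition $\mathrm{D}_{\mathrm{weak}}$.
   Context: $\omega=\{0,1,2,\dots\}$, and each $n\in\omega$ is identified with $\{0,\dots,n-1\}$. An ideal on $\omega$ is a family of subsets of $\omega$ closed under subsets and finite unions; all ideals are assumed to contain every finite subset of $\omega$ and not to contain $\omega$. An ideal $\mathcal{I}$ is a P-ideal if for each sequence $(A_n)$ in $\mathcal{I}$ there is $A\in\mathcal{I}$ with $A_n\setminus A$ finite for all $n$; it is analytic if it is an analytic subset of $\{0,1\}^\omega$ (Cantor topology), identifying sets with characteristic functions. A lower semicontinuous submeasure (lscsm) on $\omega$ is a function $\varphi:\mathcal{P}(\omega)\to[0,\infty]$ that is monotone and subadditive, with $\varphi(\emptyset)=0$, $\varphi(\{n\})<\infty$ for all $n$, and $\varphi(A)=\lim_n\varphi(A\cap n)$ for all $A\subseteq\omega$. Its support is $\mathrm{supp}(\varphi)=\{n\in\omega:\varphi(\{n\})\neq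 0\}$. Put $\|A\|_\varphi=\inf\{\varphi(A\setminus F): F\subseteq\omega\text{ finite}\}$ and $\mathrm{Exh}(\varphi)=\{A\subseteq\omega:\|A\|_\varphi=0\}$. (By a theorem of Solecki, an ideal is an analytic P-ideal if and only if it equals $\mathrm{Exh}(\varphi)$ for some lscsm $\varphi$ with $\varphi(\omega)<\infty$.) An ideal $\mathcal{I}$ is a generalized density ideal if $\mathcal{I}=\mathrm{Exh}(\sup_n\mu_n)$ (pointwise supremum) for some sequence $(\mu_n)_{n\in\omega}$ of lscsms with finite pairwise disjoint supports. Let $\mathscr{H}$ be the set of strictly increasing sequences in $\omega$, and let $\mathcal{F}_{\mathrm{incr}}$ be the set of sequences $F=(F_n)_{n\in\omega}$ of nonempty finite subsets of $\omega$ with $\max F_n<\min F_{n+1}$ for all $n$. For $s=(s_n)\in\mathscr{H}$ and $F\in\mathcal{F}_{\mathrm{incr}}$ let $$K_{s,F}=\{(k_n)\in\mathscr{H}:\ \forall n\in\omega\ \exists m\in\omega,\ \max F_{k_n}\le s_m<\min F_{k_{n+1}}\}.$$ A lscsm $\varphi$ satisfies condition $\mathrm{D}_{\mathrm{weak}}$ if for all $\varepsilon>0$ there exist $\delta>0$ and $s\in\mathscr{H}$ such that, whenever $F=(F_n)\in\mathcal{F}_{\mathrm{incr}}$ satisfies $\varphi(F_n)<\delta$ for all $n$ and $k=(k_n)\in K_{s,F}$, one has $\varphi(\bigcup_n F_{k_n})<\varepsilon$. A lscsm $\varphi$ satisfies condition $\mathrm{D}_{\mathrm{strong}}$ if there exists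 $s\in\mathscr{H}$ such that for all $\varepsilon>0$ there exists $\delta>0$ such that, whenever $F=(F_n)\in\mathcal{F}_{\mathrm{incr}}$ satisfies $\varphi(F_n)<\delta$ for all $n$ and $k=(k_n)\in K_{s,F}$, one has $\varphi(\bigcup_n F_{k_n})<\varepsilon$. *)

(* Defs.v *)
From HB Require Import structures.
From mathcomp Require Import all_boot all_order all_algebra finmap.
From mathcomp Require Import all_classical all_reals all_analysis.

Set Implicit Arguments.
Unset Strict Implicit.
Unset Printing Implicit Defensive.

Import Order.TTheory GRing.Theory Num.Theory.

Local Open Scope classical_set_scope.
Local Open Scope ereal_scope.

Record is_ideal (I : set (set nat)) : Prop := {
  ideal_subset : forall A B, A `<=` B -> I B -> I A;
  ideal_setU : forall A B, I A -> I B -> I (A `|` B);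
  ideal_finite : forall A, finite_set A -> I A;
  ideal_proper : ~ I setT
}.

Definition is_P_ideal (I : set (set nat)) : Prop :=
  is_ideal I /\
  forall A : nat -> set nat, (forall n, I (A n)) ->
    exists B, I B /\ forall n, finite_set (A n `\` B).

(* The library's topology on [nat] is the discrete one. *)
Definition baire_space : Type := prod_topology (fun _ : nat => nat).
HB.instance Definition _ := Topological.on baire_space.

Definition analytic_set (T : topologicalType) (A : set T) : Prop :=
  A = set0 \/ exists f : baire_space -> T, continuous f /\ range f = A.

(* [x : cantor_space] is the characteristic function of [[set n | x n]]. *)
Definition analytic_family (I : set (set nat)) : Prop :=
  analytic_set [set x : cantor_space | I [set n | x n]].

Definition is_analytic_P_ideal (I : set (set nat)) : Prop :=
  is_P_ideal I /\ analytic_family I.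

Record lscsm (R : realType) (phi : set nat -> \bar R) : Prop := {
  lscsm_ge0 : forall A, 0 <= phi A;
  lscsm_mono : forall A B, A `<=` B -> phi A <= phi B;
  lscsm_subadd : forall A B, phi (A `|` B) <= phi A + phi B;
  lscsm_set0 : phi set0 = 0;
  lscsm_fin : forall n, phi [set n] < +oo;
  lscsm_lsc : forall A, phi (A `&` `I_n) @[n --> \oo] --> phi A
}.

Definition supp (R : realType) (phi : set nat -> \bar R) : set nat :=
  [set n | phi [set n] <> 0].

Definition submeasure_norm (R : realType) (phi : set nat -> \bar R)
    (A : set nat) : \bar R :=
  ereal_inf [set phi (A `\` F) | F in [set F | finite_set F]].

Definition Exh (R : realType) (phi : set nat -> \bar R) : set (set nat) :=
  [set A | submeasure_norm phi A = 0].

Definition generalized_density_ideal (R : realType) (I : set (set nat)) : Prop :=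
  exists mu : nat -> set nat -> \bar R,
    [/\ forall n, lscsm (mu n),
        forall n, finite_set (supp (mu n)),
        trivIset setT (fun n => supp (mu n)) &
        I = Exh (fun A => ereal_sup [set mu n A | n in setT])].

Definition strictly_increasing (s : nat -> nat) : Prop :=
  {homo s : m n / (m < n)%N}.

(* Maximum and minimum of a nonempty finite set; [fset_max A] is a neutral
   starting value for the minimum. *)
Definition fset_max (A : {fset nat}) : nat := (\max_(i <- A) i)%N.
Definition fset_min (A : {fset nat}) : nat :=
  (\big[minn/fset_max A]_(i <- A) i)%N.

Definition F_incr (F : nat -> {fset nat}) : Prop :=
  (forall n, F n <> fset0) /\
  (forall n, (fset_max (F n) < fset_min (F n.+1))%N).

Definition K (s : nat -> nat) (F : nat -> {fset nat}) : set (nat -> nat) :=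
  [set k | strictly_increasing k /\
    forall n, exists m, (fset_max (F (k n)) <= s m < fset_min (F (k n.+1)))%N].

Definition D_weak (R : realType) (phi : set nat -> \bar R) : Prop :=
  forall eps : R, (0 < eps)%R ->
  exists (delta : R) (s : nat -> nat),
    [/\ (0 < delta)%R, strictly_increasing s &
      forall F k, F_incr F -> (forall n, phi [set` F n] < delta%:E) ->
        K s F k -> phi (\bigcup_n [set` F (k n)]) < eps%:E].

Definition D_strong (R : realType) (phi : set nat -> \bar R) : Prop :=
  exists s : nat -> nat, strictly_increasing s /\
  forall eps : R, (0 < eps)%R ->
  exists delta : R, (0 < delta)%R /\
    forall F k, F_incr F -> (forall n, phi [set` F n] < delta%:E) ->
      K s F k -> phi (\bigcup_n [set` F (k n)]) < eps%:E.

(* Main.v *)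
Require Import Defs.
From mathcomp Require Import all_boot all_order all_algebra finmap.
From mathcomp Require Import all_classical all_reals all_analysis.
From mathcomp Require Import ring lra.

(** Passing from a property of all the submeasures that represent the ideal [I] to
the existence of one that has it needs Solecki's theorem: an analytic P-ideal
has the form [Exh phi] ([analytic_P_ideal_Exh]). The other implications are
about a given submeasure.

Solecki's theorem. Let [g], from the Baire space, be continuous with range [I].
A node [s] is cofinal when every [x] in [I] is almost contained in [g a] for
some branch [a] through [s]. As [I] is a P-ideal, countably many non-cofinal
nodes can be avoided at once, so the branches may be taken with cofinal nodes
only. For a cofinal [s], the closed hereditary set [approx s], generated by the
[g a] for such branches [a] through [s], contains a tail of every member of [I].
Call a closed hereditary family with that property large. Two facts carry the
argument.
- If some tail of [x] lies in [approx s] for every cofinal [s], then [x] is in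
  [I] ([approx_mem]): two branches [a] and [b] are built in alternation so that
  each covers the gaps left by the other, whence [x] is contained in
  [g a `|` g b] up to a finite set.
- A large [K] contains all the unions of two members of some large [L]
  ([large_half]): otherwise two branches could be built with
  [g a `|` g b] having no tail in [K].
Iterating the second fact and intersecting with the [approx s] gives large
families [K n] with threefold unions of members of [K n.+1] in [K n], such that
[x] is in [I] if and only if each [K n] contains a tail of [x]. The metrization
argument of Birkhoff, Kakutani and Frink turns them into a submeasure [phi] such
that [K n] lies between the open and the closed ball of radius [2^-1 ^+ n].

The remaining implications. When [Exh psi `<=` Exh phi], small [psi] forces
small [phi] on sets that start late enough ([Exh_sub_continuous], a gliding hump
argument). Let [I = Exh psi] with [psi] the supremum of the [mu n]. Choosing [s]
so that no support of a [mu n] crosses two consecutive points of [s], each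
support meets at most two consecutive sets [F (k n)] with [k] in [K s F], and
the strong condition follows for every [phi] that represents [I]. Conversely,
from the weak condition one builds [t] such that each interval
[[t n, t n.+1[] from the [j]-th one on contains a point of the sequence
attached to [2^-1 ^+ j]. Then [phi] restricted to these intervals gives the
[mu n]: the intervals of even index are separated by those points, and so are
those of odd index, so the weak condition bounds [phi] on each of the two
unions. *)

Set Implicit Arguments.
Unset Strict Implicit.
Unset Printing Implicit Defensive.

Import Order.TTheory GRing.Theory Num.Theory.

Local Open Scope classical_set_scope.

(** * Choice, finite sets of naturals, continuity on the Baire space *)

(** Dependent choice along an invariant, with a step relation that may depend
on the stage. *)
Lemma dep_choice (T : Type) (Inv : T -> Prop) (P : nat -> T -> T -> Prop)
    (x0 : T) :
  Inv x0 -> (forall n x, Inv x -> exists y, Inv y /\ P n x y) ->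
  exists u : nat -> T, u 0%N = x0 /\
    forall n, Inv (u n) /\ P n (u n) (u n.+1).
Proof.
move=> Ix0 step.
have /choice[h hP] (q : nat * T) :
    exists y, Inv q.2 -> Inv y /\ P q.1 q.2 y.
  have [Iq|nIq] := pselect (Inv q.2); last by exists q.2.
  by have [y ?] := step q.1 _ Iq; exists y.
pose u := fix u n := if n is m.+1 then h (m, u m) else x0.
have Iu n : Inv (u n) by elim: n => // n IH; have [] := hP (n, u n) IH.
exists u; split=> // n; split=> //.
by have [] := hP (n, u n) (Iu n).
Qed.

Lemma finite_set_nat_bounded (A : set nat) :
  finite_set A -> exists m, A `<=` `I_m.
Proof.
move=> /finite_fsetP[X ->]; exists (\max_(i <- X) i).+1 => i /= iX.
by rewrite ltnS; apply: leq_bigmax_seq.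
Qed.

Lemma bounded_finite_set (A : set nat) m : A `<=` `I_m -> finite_set A.
Proof. by move=> /sub_finite_set; apply; exact: finite_II. Qed.

Lemma setD_II_le (x : set nat) m n : (m <= n)%N -> x `\` `I_n `<=` x `\` `I_m.
Proof.
move=> mn i /= [xi ni]; split=> // im; apply: ni; exact: leq_trans im mn.
Qed.

(** Continuity on the Baire space: finitely many values of the image are
    determined by finitely many values of the argument. *)
Lemma continuous_baire_cantor (f : baire_space -> cantor_space) :
  continuous f -> forall (a : baire_space) k, exists n, forall b : baire_space,
    (forall i, (i < n)%N -> b i = a i) ->
    forall i, (i < k)%N -> f b i = f a i.
Proof.
move=> fc a; elim=> [|k [n IH]]; first by exists 0%N.
suff [m mP] : exists m, forall b : baire_space,
    (forall i, (i < m)%N -> b i = a i) -> f b k = f a k.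
  exists (maxn n m) => b ba i; rewrite ltnS leq_eqVlt => /orP[/eqP->|ik].
    by apply: mP => j jm; apply: ba; rewrite leq_max jm orbT.
  by apply: IH => // j jn; apply: ba; rewrite leq_max jn.
apply: contrapT => H.
have /choice[b bP] m : exists b : baire_space,
    (forall i, (i < m)%N -> b i = a i) /\ f b k <> f a k.
  apply: contrapT => H'; apply: H; exists m => b bm.
  by apply: contrapT => ?; apply: H'; exists b.
have ba : b n @[n --> \oo] --> a.
  apply/cvg_sup => i U; rewrite nbhsE => -[B [[C oC <-] /= Cai] BU].
  exists i.+1 => // m /= im; apply: BU => /=.
  by have [-> ] := bP m.
have fk : (fun g : baire_space => f g k) @ a --> f a k.
  apply: (@continuous_comp _ _ _ f (fun h : cantor_space => h k)); first exact: fc.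
  exact: (@proj_continuous nat (fun=> bool) k).
have /(_ [set f a k]) := cvg_comp b (fun g : baire_space => f g k) ba fk.
case; first exact: discrete_set1.
by move=> N _ /(_ N (leqnn N)) /= fN; have [] := bP N.
Qed.

(** * Filtrations of analytic P-ideals *)

(** The basic open set of all the branches through the node [s]. *)
Definition cyl (s : seq nat) : set (nat -> nat) :=
  [set a | forall i, (i < size s)%N -> a i = nth 0%N s i].

Lemma cyl_nth s : cyl s (nth 0%N s).
Proof. by []. Qed.

Lemma cyl_mkseq (a b : nat -> nat) n :
  cyl (mkseq a n) b <-> forall i, (i < n)%N -> b i = a i.
Proof.
by rewrite /cyl /= size_mkseq; split=> ba i /[dup] lin /ba ->; rewrite nth_mkseq.
Qed.

Lemma cyl_mkseq_sub s (a : nat -> nat) n :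
  cyl s a -> (size s <= n)%N -> cyl (mkseq a n) `<=` cyl s.
Proof.
by move=> sa sn b /cyl_mkseq ba i lis; rewrite ba ?sa//; exact: leq_trans sn.
Qed.

(** Nested nodes of unbounded length determine a branch through all of them. *)
Lemma cyl_limit (u : nat -> seq nat) :
  (forall n, cyl (u n.+1) `<=` cyl (u n)) -> (forall n, (n <= size (u n))%N) ->
  exists a, forall n, cyl (u n) a.
Proof.
move=> usub usize; exists (fun i => nth 0%N (u i.+1) i) => n i ilt.
have mono m k : (m <= k)%N -> cyl (u k) `<=` cyl (u m).
  elim: k => [|k IH]; first by rewrite leqn0 => /eqP ->.
  rewrite leq_eqVlt => /orP[/eqP->//|/IH mk]; exact: subset_trans (usub k) mk.
set N := maxn n i.+1; have c := @cyl_nth (u N).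
rewrite -(mono i.+1 N (leq_maxr _ _) _ c i (usize _)).
by rewrite (mono n N (leq_maxl _ _) _ c i ilt).
Qed.

Section Solecki.
(* [g] parametrizes [I] continuously by the branches, that is, by the points of
   the Baire space. *)
Context (I : set (set nat)) (g : (nat -> nat) -> set nat).
Hypothesis hI : is_P_ideal I.
Hypothesis gI : forall A, I A <-> exists a, g a = A.
Hypothesis gcont : forall a k, exists n, forall b,
  (forall i, (i < n)%N -> b i = a i) -> g b `&` `I_k = g a `&` `I_k.

Let Isub : forall A B, A `<=` B -> I B -> I A.
Proof. exact: ideal_subset hI.1. Qed.

Let IU : forall A B, I A -> I B -> I (A `|` B).
Proof. exact: ideal_setU hI.1. Qed.

Let Ig a : I (g a).
Proof. by apply/gI; exists a. Qed.

Let Ibnd A m : A `<=` `I_m -> I A.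
Proof. by move=> /bounded_finite_set; exact: ideal_finite hI.1 _. Qed.

(** The image of the cylinder of [s] is cofinal in [I] for almost inclusion.
Almost inclusion is expressed with the tails [x `\` `I_m]. *)
Definition cofinal s := forall x, I x ->
  exists a, cyl s a /\ exists m, x `\` `I_m `<=` g a.

(** All the nodes of the branch [a] are cofinal. *)
Definition cofinal_branch a := forall n, cofinal (mkseq a n).

(** The closure of the hereditary family generated by the [g a], for [a] a
cofinal branch through [s]. *)
Definition approx s : set (set nat) :=
  [set z | forall k, exists a,
    [/\ cyl s a, cofinal_branch a & z `&` `I_k `<=` g a]].

(** A hereditary family [K], closed in the Cantor topology, that contains a tail
of every member of [I]. For a hereditary [K], closedness means that [K] contains
every set all of whose initial segments it contains. *)
Record large (K : set (set nat)) : Prop := {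
  large_sub : forall A B, A `<=` B -> K B -> K A;
  large_closed : forall A, (forall k, K (A `&` `I_k)) -> K A;
  large_tail : forall A, I A -> exists m, K (A `\` `I_m)
}.

Lemma cofinal_nil : cofinal [::].
Proof.
move=> x /gI[a <-]; exists a; split; first by move=> i.
by exists 0%N => i [].
Qed.

Lemma P_ideal_bound (T : countType) (A : T -> set nat) : (forall t, I (A t)) ->
  exists B, I B /\ forall t, exists m, A t `\` `I_m `<=` B.
Proof.
move=> IA; pose A' n := if @choice.unpickle T n is Some t then A t else set0.
have [|B [IB BA]] := hI.2 A'.
  by move=> n; rewrite /A'; case: choice.unpickle => [t|] //; exact: (@Ibnd _ 0%N).
exists B; split=> // t; have /finite_set_nat_bounded[m mP] := BA (choice.pickle t).
exists m => i [Ai im]; apply: contrapT => Bi; apply: im; apply: mP; split=> //.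
by rewrite /A' choice.pickleK.
Qed.

(** Each non-cofinal node [t] has a witness [e t] in [I]; an [x] enlarged by an
almost upper bound of all the witnesses is almost contained only in images of
branches that avoid those nodes. *)
Lemma cofinal_branch_in s x : cofinal s -> I x ->
  exists a, [/\ cyl s a, cofinal_branch a & exists m, x `\` `I_m `<=` g a].
Proof.
move=> cs Ix.
have /choice[e eP] (t : seq nat) : exists y, I y /\ (~ cofinal t ->
    forall a, cyl t a -> ~ exists m, y `\` `I_m `<=` g a).
  have [ct|/existsNP[y /not_implyP[Iy yt]]] := pselect (cofinal t).
    by exists set0; split=> //; exact: (@Ibnd _ 0%N).
  by exists y; split=> // _ a ta my; apply: yt; exists a.
have [B [IB eB]] := P_ideal_bound (fun t => (eP t).1).
have [a [sa [m mP]]] := cs _ (IU Ix IB).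
exists a; split=> //; last first.
  by exists m => i [xi im]; apply: mP; split=> //; left.
move=> n; apply: contrapT => nc.
have na : cyl (mkseq a n) a by apply/cyl_mkseq.
apply: ((eP (mkseq a n)).2 nc a na).
have [p pP] := eB (mkseq a n).
exists (maxn m p) => i [ei /negP]; rewrite /= -leqNgt geq_max => /andP[mi pi].
apply: mP; split; last by apply/negP; rewrite -leqNgt.
by right; apply: pP; split=> //; apply/negP; rewrite -leqNgt.
Qed.

Lemma approx_large s : cofinal s -> large (approx s).
Proof.
move=> cs; split.
- move=> A B AB HB k; have [a [sa ca Ba]] := HB k; exists a; split=> //.
  by move=> i [/AB Bi ik]; apply: Ba.
- move=> A HA k; have [a [sa ca Aa]] := HA k k; exists a; split=> //.
  by rewrite -setIA setIid in Aa.
- move=> A IA; have [a [sa ca [m mP]]] := cofinal_branch_in cs IA.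
  by exists m => k; exists a; split=> //; apply: subset_trans mP; exact: subIsetl.
Qed.

Lemma large_tailW K A m n : large K -> (m <= n)%N -> K (A `\` `I_m) ->
  K (A `\` `I_n).
Proof. by move=> lK mn; apply: (large_sub lK); exact: setD_II_le. Qed.

Lemma largeI K L : large K -> large L -> large (K `&` L).
Proof.
move=> lK lL; split.
- by move=> A B AB [KB LB]; split;
    [exact: (large_sub lK AB KB)|exact: (large_sub lL AB LB)].
- by move=> A KA; split; [apply: (large_closed lK)|apply: (large_closed lL)];
    move=> k; have [] := KA k.
- move=> A IA; have [m mP] := large_tail lK IA; have [n nP] := large_tail lL IA.
  exists (maxn m n); split.
    by apply: large_tailW mP; rewrite ?leq_maxl.
  by apply: large_tailW nP; rewrite ?leq_maxr.
Qed.

(** The family of the [approx s], for [s] cofinal, determines [I]. *)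
Lemma approx_mem x :
  (forall s, cofinal s -> exists m, approx s (x `\` `I_m)) -> I x.
Proof.
move=> H.
(* As [mu s] is at least the size of [s], it is unbounded along the construction. *)
have /choice[mu muP] s : exists m, cofinal s ->
    approx s (x `\` `I_m) /\ (size s <= m)%N.
  have [cs|?] := pselect (cofinal s); last by exists 0%N.
  have [m mP] := H _ cs; exists (maxn m (size s)) => _; split.
    by apply: large_tailW mP; rewrite ?leq_maxl//; exact: approx_large.
  by rewrite leq_maxr.
(* The state holds two consecutive nodes of a single sequence [r]; the even and
   the odd terms of [r] are the nodes of the two branches. *)
pose Inv (q : seq nat * seq nat) := cofinal q.1 /\ cofinal q.2.
pose P (n : nat) (q r : seq nat * seq nat) := [/\ r.1 = q.2,
  cyl r.2 `<=` cyl q.1, (size q.1 < size r.2)%N &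
  forall b, cyl r.2 b -> x `&` [set i | (mu q.1 <= i < mu q.2)%N] `<=` g b].
have [] := @dep_choice _ Inv P ([::], [::]).
- by split; exact: cofinal_nil.
- move=> n0 [s t] [/= cs ct]; have [ap _] := muP _ cs.
  have [a [sa ca xa]] := ap (mu t).
  have [n nP] := gcont a (mu t).
  pose N := maxn n (size s).+1.
  exists (t, mkseq a N); split; first by split=> //=; exact: ca.
  split=> //=.
  + by apply: cyl_mkseq_sub => //; rewrite ltnW// leq_maxr.
  + by rewrite size_mkseq leq_maxr.
  move=> b /cyl_mkseq ba i [xi /= /andP[si it]].
  have [] : (g b `&` `I_(mu t)) i; last by [].
  rewrite nP; last by move=> j jn; apply: ba; rewrite leq_max jn.
  split=> //; apply: xa; split=> //; split=> //=.
  by apply/negP; rewrite -leqNgt.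
move=> w [w0 wP].
pose r n := (w n).1.
have r1 n : r n.+1 = (w n).2 by have [_ []] := wP n.
have cr n : cofinal (r n) by have [[]] := wP n.
have rP n : [/\ cyl (r n.+2) `<=` cyl (r n), (size (r n) < size (r n.+2))%N &
    forall b, cyl (r n.+2) b ->
      x `&` [set i | (mu (r n) <= i < mu (r n.+1))%N] `<=` g b].
  by rewrite !r1; have [_ [_]] := wP n; rewrite -!r1.
have rsize n : (n <= size (r n.*2))%N /\ (n <= size (r n.*2.+1))%N.
  elim: n => // n [IH0 IH1]; rewrite doubleS.
  have [_ e0 _] := rP n.*2; have [_ e1 _] := rP n.*2.+1.
  by split; [exact: leq_ltn_trans IH0 e0|exact: leq_ltn_trans IH1 e1].
have [a aP] : exists a, forall n, cyl (r n.*2) a.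
  apply: cyl_limit => n; last by have [] := rsize n.
  by rewrite doubleS; have [] := rP n.*2.
have [b bP] : exists b, forall n, cyl (r n.*2.+1) b.
  apply: cyl_limit => n; last by have [] := rsize n.
  by rewrite doubleS; have [] := rP n.*2.+1.
have Iab : I (g a `|` g b `|` `I_(mu (r 0%N))).
  by apply: IU; [exact: IU|exact: (@Ibnd _ (mu (r 0%N)))].
apply: Isub Iab => i xi.
(* The intervals from [mu (r p)] to [mu (r p.+1)] cover the tail of [x], and the
   branch of the parity of [p] takes care of the [p]-th one. *)
have [|mi] := ltnP i (mu (r 0%N)); first by right.
left; have exN : exists p, (i < mu (r p))%N.
  exists i.+1.*2; have [_ le] := muP _ (cr i.+1.*2).
  by apply: leq_trans le; have [] := rsize i.+1.
case: (ex_minnP exN) => -[|p] ip pmin; first by rewrite ltnNge mi in ip.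
have pi : (mu (r p) <= i)%N.
  by rewrite leqNgt; apply/negP => /pmin; rewrite ltnn.
have [_ _ gP] := rP p; case: (boolP (odd p)) => [po|pe].
- right; apply: (gP b); last by split=> //=; rewrite pi.
  by rewrite (_ : p.+2 = p./2.+1.*2.+1)// doubleS -{1}(odd_double_half p) po.
- left; apply: (gP a); last by split=> //=; rewrite pi.
  by rewrite (_ : p.+2 = p./2.+1.*2)// doubleS -{1}(odd_double_half p) (negbTE pe).
Qed.


(** If a large [K] failed the conclusion, two branches could be built whose
images have a union, in [I], that has no tail in [K]. *)
Lemma large_half_nodes K : large K ->
  exists s t m, [/\ cofinal s, cofinal t & forall a b, cyl s a -> cyl t b ->
    cofinal_branch a -> cofinal_branch b -> K ((g a `|` g b) `\` `I_m)].
Proof.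
move=> lK; apply: contrapT => H.
pose Inv (q : seq nat * seq nat) := cofinal q.1 /\ cofinal q.2.
pose P (n : nat) (q r : seq nat * seq nat) :=
  [/\ cyl r.1 `<=` cyl q.1, cyl r.2 `<=` cyl q.2,
  (size q.1 < size r.1)%N, (size q.2 < size r.2)%N &
  forall a b, cyl r.1 a -> cyl r.2 b -> ~ K ((g a `|` g b) `\` `I_n)].
have [] := @dep_choice _ Inv P ([::], [::]).
- by split; exact: cofinal_nil.
- move=> n [s t] [/= cs ct].
  have [a [b [sa tb ca cb nK]]] : exists a b, [/\ cyl s a, cyl t b,
      cofinal_branch a, cofinal_branch b & ~ K ((g a `|` g b) `\` `I_n)].
    apply: contrapT => H'; apply: H; exists s, t, n; split=> // a b sa tb ca cb.
    by apply: contrapT => nK; apply: H'; exists a, b.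
  have [k kK] : exists k, ~ K (((g a `|` g b) `\` `I_n) `&` `I_k).
    apply: contrapT => H'; apply: nK; apply: (large_closed lK) => k.
    by apply: contrapT => nK; apply: H'; exists k.
  have [p pP] := gcont a k; have [q qP] := gcont b k.
  exists (mkseq a (maxn p (size s).+1), mkseq b (maxn q (size t).+1)).
  split; first by split=> /=; [exact: ca|exact: cb].
  split=> /=.
  + by apply: cyl_mkseq_sub => //; rewrite ltnW// leq_maxr.
  + by apply: cyl_mkseq_sub => //; rewrite ltnW// leq_maxr.
  + by rewrite size_mkseq leq_maxr.
  + by rewrite size_mkseq leq_maxr.
  move=> a' b' /cyl_mkseq aa' /cyl_mkseq bb' HK; apply: kK.
  suff e : (g a `|` g b) `&` `I_k = (g a' `|` g b') `&` `I_k.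
    apply: (large_sub lK _ HK) => i [[gi iN] ik]; split=> //.
    suff [] : ((g a' `|` g b') `&` `I_k) i by [].
    by rewrite -e.
  rewrite !setIUl; congr (_ `|` _); apply/esym; [apply: pP|apply: qP] => i ip.
    by apply: aa'; rewrite leq_max ip.
  by apply: bb'; rewrite leq_max ip.
move=> w [w0 wP].
have wsize n : (n <= size (w n).1)%N /\ (n <= size (w n).2)%N.
  elim: n => // n [IH1 IH2]; have [_ [_ _ s1 s2 _]] := wP n.
  by split; [exact: leq_ltn_trans IH1 s1|exact: leq_ltn_trans IH2 s2].
have [a aP] : exists a, forall n, cyl (w n).1 a.
  by apply: cyl_limit => n; [have [_ []] := wP n|have [] := wsize n].
have [b bP] : exists b, forall n, cyl (w n).2 b.
  by apply: cyl_limit => n; [have [_ []] := wP n|have [] := wsize n].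
have [m mK] := large_tail lK (IU (Ig a) (Ig b)).
have [_ [_ _ _ _]] := wP m; exact.
Qed.

(** The large [L] consists of the sets that both nodes of [large_half_nodes]
approximate, starting late enough. *)
Lemma large_half K : large K ->
  exists L, large L /\ forall A B, L A -> L B -> K (A `|` B).
Proof.
move=> lK; have [s [t [m [cs ct stK]]]] := large_half_nodes lK.
exists (approx s `&` approx t `&` [set A | A `&` `I_m = set0]); split.
  have lst := largeI (approx_large cs) (approx_large ct).
  split.
  - move=> A B AB [stB Bm]; split; first exact: (large_sub lst AB).
    by apply/seteqP; split=> // i [/AB Bi im]; rewrite -Bm.
  - move=> A HA; split.
      by apply: (large_closed lst) => k; have [] := HA k.
    apply/seteqP; split=> // i [Ai im]; have [_ <-] := HA i.+1.
    by split=> //; split=> //=.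
  - move=> A /(large_tail lst)[n nP]; exists (maxn n m); split.
      by apply: (large_tailW lst) nP; rewrite leq_maxl.
    apply/seteqP; split=> // i [[_ /negP]]; rewrite -leqNgt geq_max.
    by move=> /andP[_ mi] /=; rewrite ltnNge mi.
move=> A B [[sA _] Am] [[_ tB] Bm]; apply: (large_closed lK) => k.
have [a [sa ca Aa]] := sA k; have [b [tb cb Bb]] := tB k.
apply: (large_sub lK _ (stK _ _ sa tb ca cb)) => i [ABi ik]; split.
  by case: ABi => ?; [left; apply: Aa|right; apply: Bb].
move=> im; case: ABi => ?; first by rewrite -[False]/(set0 i) -Am.
by rewrite -[False]/(set0 i) -Bm.
Qed.

(** An analytic P-ideal is the set of all [A] having, for each [n], a tail in
[K n], for closed hereditary families [K n] that shrink under unions. *)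
Lemma P_ideal_filtration : exists K : nat -> set (set nat),
  [/\ K 0%N = setT,
      forall n A B, A `<=` B -> K n B -> K n A,
      forall n A, (forall k, K n (A `&` `I_k)) -> K n A,
      forall n A B C, K n.+1 A -> K n.+1 B -> K n.+1 C ->
        K n (A `|` B `|` C) &
      forall A, I A <-> forall n, exists m, K n (A `\` `I_m)].
Proof.
have lT : large setT by split=> // A _; exists 0%N.
(* Stage [n] deals with the node of code [n], if there is one and it is cofinal. *)
have step n (K : set (set nat)) : large K -> exists L, large L /\
    ((forall A B C, L A -> L B -> L C -> K (A `|` B `|` C)) /\
    forall s, choice.pickle s = n -> cofinal s -> L `<=` approx s).
  move=> lK; have [L [lL LK]] := large_half lK.
  have [M [lM ML]] := large_half lL.
  have sM A : M A -> L A by move=> MA; rewrite -[A]setUid; exact: ML.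
  have [[s [sn cs]]|ns] := pselect (exists s, choice.pickle s = n /\ cofinal s).
    exists (M `&` approx s); split; first exact: largeI (approx_large cs).
    split.
      by move=> A B C [MA _] [MB _] [MC _]; apply: LK; [exact: ML|exact: sM].
    move=> t tn _ A [_]; suff -> : t = s by [].
    by apply: (pcan_inj choice.pickleK); rewrite sn tn.
  exists M; split=> //; split.
    by move=> A B C MA MB MC; apply: LK; [exact: ML|exact: sM].
  by move=> s sn cs; case: ns; exists s.
have [K [K0 KP]] := dep_choice lT step.
exists K; split=> //.
- by move=> n; apply: large_sub; have [] := KP n.
- by move=> n; apply: large_closed; have [] := KP n.
- by move=> n; have [_ []] := KP n.
move=> A; split.
  by move=> IA n; apply: large_tail => //; have [] := KP n.
move=> H; apply: approx_mem => s cs.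
have [m mP] := H (choice.pickle s).+1; exists m.
by have [_ [_ ]] := KP (choice.pickle s); apply.
Qed.

End Solecki.

(** * Metrization of a filtration by a submeasure *)

Section Metrization.
Context (R : realType) (K : nat -> set (set nat)).
Hypothesis K0 : K 0%N = setT.
Hypothesis Kset0 : forall n, K n set0.
Hypothesis Ksub : forall n A B, A `<=` B -> K n B -> K n A.
Hypothesis Kclosed : forall n A, (forall k, K n (A `&` `I_k)) -> K n A.
Hypothesis KU : forall n A B C, K n.+1 A -> K n.+1 B -> K n.+1 C ->
  K n (A `|` B `|` C).

Local Open Scope ring_scope.

Let pw (n : nat) : R := 2^-1 ^+ n.

Let pw_gt0 n : 0 < pw n. Proof. by rewrite exprn_gt0. Qed.

Let pwS n : pw n = pw n.+1 + pw n.+1.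
Proof. by rewrite /pw exprS; field. Qed.

Let pw_lt m n : pw m < pw n -> (n < m)%N.
Proof. by rewrite /pw ltr_iXn2l// ?invf_lt1// ltr1n. Qed.

Let K_anti m n A : (m <= n)%N -> K n A -> K m A.
Proof.
elim: n => [|n IH]; first by rewrite leqn0 => /eqP ->.
rewrite leq_eqVlt => /orP[/eqP->//|mn KA]; apply: IH => //.
by apply: Ksub (KU KA KA KA) => i; left; left.
Qed.

(** [A] is covered by sets [B_i] in [K n_i], where the [n_i] are listed in [s]. *)
Fixpoint covered (s : seq nat) (A : set nat) : Prop :=
  if s is n :: t then exists B C, [/\ K n B, covered t C & A `<=` B `|` C]
  else A `<=` set0.

(** The cost of a cover by members of the [K n], for [n] in [s]. *)
Definition weight (s : seq nat) : R := \sum_(n <- s) 2^-1 ^+ n.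

Let weight_cons n s : weight (n :: s) = pw n + weight s.
Proof. by rewrite /weight big_cons. Qed.

Let weight_cat s t : weight (s ++ t) = weight s + weight t.
Proof. by rewrite /weight big_cat. Qed.

Let weight_ge0 s : 0 <= weight s.
Proof. by apply: sumr_ge0 => n _; exact: ltW (pw_gt0 n). Qed.

Lemma covered_sub s A B : A `<=` B -> covered s B -> covered s A.
Proof.
case: s => [|n s] /= AB; first exact: subset_trans.
by move=> [C [D [KC sD BCD]]]; exists C, D; split=> //; exact: subset_trans BCD.
Qed.

Lemma covered_cat s t A B :
  covered s A -> covered t B -> covered (s ++ t) (A `|` B).
Proof.
elim: s A => [|n s IH] A /=.
  by move=> A0; apply: covered_sub => i [/A0|].
move=> [C [D [KC sD ACD]]] tB; exists C, (D `|` B); split=> //; first exact: IH.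
by rewrite setUA => i [/ACD|]; [left|right].
Qed.

Lemma covered_catP s t A : covered (s ++ t) A ->
  exists B C, [/\ covered s B, covered t C & A `<=` B `|` C].
Proof.
elim: s A => [|n s IH] A /=.
  by move=> tA; exists set0, A; split=> //; right.
move=> [B [C [KB /IH[D [E [sD tE CDE]]] ABC]]].
exists (B `|` D), E; split=> //; first by exists B, D; split.
by rewrite -setUA => i /ABC[Bi|/CDE]; [left|right].
Qed.

Lemma weight_split s c : 0 <= c -> c < weight s ->
  exists s1 n s2, [/\ s = s1 ++ n :: s2, weight s1 <= c &
                      c < weight s1 + 2^-1 ^+ n].
Proof.
elim: s c => [|n s IH] c c0; first by rewrite /weight big_nil ltNge c0.
rewrite weight_cons => cs; have [cn|nc] := ltP c (pw n).
  by exists [::], n, s; rewrite /weight big_nil add0r.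

have [||s1 [m [s2 [-> s1c cs1]]]] := IH (c - pw n).
- by rewrite subr_ge0.
- by rewrite ltrBlDl.
exists (n :: s1), m, s2; split=> //; rewrite weight_cons.
  by rewrite -lerBrDl.
by rewrite -addrA -ltrBlDl.
Qed.

(** Frink's lemma. The list is cut at the entry where the partial weight passes
one half of the total: both sides lie in [K n.+1] by induction, and so does the
entry itself. *)
Lemma covered_lt s n A : covered s A -> weight s < 2^-1 ^+ n -> K n A.
Proof.
elim: (size s).+1 {-2}s (ltnSn (size s)) n A => // N IH {}s.
rewrite ltnS => sN n A sA sn.
have := weight_ge0 s; rewrite le_eqVlt => /orP[/eqP s0|s0].
  case: s sA s0 {sN sn} => [A0 _|m s _].
    by apply: Ksub (Kset0 n).
  rewrite weight_cons => /eqP; rewrite eq_sym gt_eqF//.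
  by rewrite ltr_wpDr.
have [||s1 [m [s2 [es s1c cs1]]]] := @weight_split s (weight s / 2).
- by rewrite divr_ge0.
- by rewrite ltr_pdivrMr// ltr_pMr// ltr1n.
have ws : weight s = weight s1 + (pw m + weight s2).
  by rewrite es weight_cat weight_cons.
have pn := pwS n; rewrite -/(pw n) in sn; rewrite -/(pw m) in cs1.
have ms : (n < m)%N.
  by apply: pw_lt; have := weight_ge0 s1; have := weight_ge0 s2; lra.
rewrite es in sA; have [B [C [s1B [D [E [KD s2E CDE]]] ABC]]] := covered_catP sA.
have sz : (size s1 < N)%N /\ (size s2 < N)%N.
  move: sN; rewrite es size_cat /= addnS => sN; split.
    by apply: leq_trans sN; rewrite ltnS leq_addr.
  by apply: leq_trans sN; rewrite ltnS leq_addl.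
have KB : K n.+1 B by apply: (IH s1) => //; [have [] := sz|rewrite -/(pw _); lra].
have KE : K n.+1 E by apply: (IH s2) => //; [have [] := sz|rewrite -/(pw _); lra].
apply: Ksub (KU KB (K_anti ms KD) KE) => i /ABC[Bi|/CDE[Di|Ei]].
- by left; left.
- by left; right.
- by right.
Qed.

Local Open Scope ereal_scope.

(** The least cost of a cover; this need not be lower semicontinuous. *)
Definition cover_inf (A : set nat) : \bar R :=
  ereal_inf [set (weight s)%:E | s in [set s | covered s A]].

Lemma cover_inf_ge0 A : 0 <= cover_inf A.
Proof. by apply/ereal_infP => _ [s _ <-]; rewrite lee_fin. Qed.

Lemma cover_inf_le A s : covered s A -> cover_inf A <= (weight s)%:E.
Proof. by move=> sA; apply: ereal_inf_lbound; exists s. Qed.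

Lemma cover_inf_K n A : K n A -> cover_inf A <= (2^-1 ^+ n)%:E.
Proof.
move=> KA; rewrite (_ : 2^-1 ^+ n = weight [:: n])%R.
  by apply: cover_inf_le; exists A, set0; split=> // i; left.
by rewrite weight_cons /weight big_nil addr0.
Qed.

Lemma cover_inf_lt n A : cover_inf A < (2^-1 ^+ n)%:E -> K n A.
Proof.
by move=> /ereal_inf_lt[_ [s sA <-]]; rewrite lte_fin; exact: covered_lt.
Qed.

Lemma cover_inf_fin A : cover_inf A \is a fin_num.
Proof.
rewrite ge0_fin_numE ?cover_inf_ge0//.
by apply: le_lt_trans (ltry (2^-1 ^+ 0)); apply: cover_inf_K; rewrite K0.
Qed.

Lemma cover_inf_mono A B : A `<=` B -> cover_inf A <= cover_inf B.
Proof.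
move=> AB; apply/ereal_infP => _ [s sB <-]; apply: cover_inf_le.
exact: covered_sub AB sB.
Qed.

Lemma cover_inf_subadd A B : cover_inf (A `|` B) <= cover_inf A + cover_inf B.
Proof.
rewrite -leeBlDl ?cover_inf_fin//; apply/ereal_infP => _ [t tB <-].
rewrite leeBlDl ?cover_inf_fin// -leeBlDr//; apply/ereal_infP => _ [s sA <-].
rewrite leeBlDr// -EFinD -weight_cat; apply: cover_inf_le.
exact: covered_cat.
Qed.

(** The lower semicontinuous submeasure with the values of [cover_inf] on
finite sets. *)
Definition metrization (A : set nat) : \bar R :=
  ereal_sup (range (fun k => cover_inf (A `&` `I_k))).

Lemma metrization_ge A k : cover_inf (A `&` `I_k) <= metrization A.
Proof. by apply: ereal_sup_ubound; exists k. Qed.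

Lemma metrization_II A k : metrization (A `&` `I_k) = cover_inf (A `&` `I_k).
Proof.
apply/eqP; rewrite eq_le; apply/andP; split.
  by apply/ereal_supP => _ [j _ <-]; apply: cover_inf_mono; exact: subIsetl.
by have := metrization_ge (A `&` `I_k) k; rewrite -setIA setIid.
Qed.

Lemma lscsm_metrization : lscsm metrization.
Proof.
split.
- by move=> A; apply: le_trans (metrization_ge A 0%N); exact: cover_inf_ge0.
- move=> A B AB; apply/ereal_supP => _ [k _ <-].
  by apply: le_trans (metrization_ge B k); apply: cover_inf_mono; exact: setSI.
- move=> A B; apply/ereal_supP => _ [k _ <-]; rewrite setIUl.
  apply: le_trans (cover_inf_subadd _ _) _.
  by apply: leeD; exact: metrization_ge.
- apply/eqP; rewrite eq_le; apply/andP; split.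
    apply/ereal_supP => _ [k _ <-]; rewrite set0I.
    have -> : 0 = (weight [::])%:E by rewrite /weight big_nil.
    exact: cover_inf_le.
  by apply: le_trans (metrization_ge _ 0%N); exact: cover_inf_ge0.
- move=> n; apply: le_lt_trans (ltry (2^-1 ^+ 0)).
  by apply/ereal_supP => _ [k _ <-]; apply: cover_inf_K; rewrite K0.
- move=> A; rewrite (_ : (fun n => metrization (A `&` `I_n)) =
      fun n => cover_inf (A `&` `I_n)); last first.
    by apply/funext => n; exact: metrization_II.
  apply: ereal_nondecreasing_cvgn => m n mn; apply: cover_inf_mono.
  by apply: setIS => i /= im; exact: leq_trans im mn.
Qed.

Lemma metrization_le n A : K n A -> metrization A <= (2^-1 ^+ n)%:E.
Proof.
move=> KA; apply/ereal_supP => _ [k _ <-]; apply: cover_inf_K.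
by apply: Ksub KA; exact: subIsetl.
Qed.

Lemma metrization_lt n A : metrization A < (2^-1 ^+ n)%:E -> K n A.
Proof.
move=> nA; apply: Kclosed => k; apply: cover_inf_lt.
exact: le_lt_trans (metrization_ge A k) nA.
Qed.

End Metrization.

Local Open Scope ereal_scope.

(** * Solecki's theorem *)

(** Membership in [Exh phi] in terms of tails. *)
Lemma ExhP (R : realType) (phi : set nat -> \bar R) A : lscsm phi ->
  Exh phi A <-> forall e : R, (0 < e)%R -> exists m, phi (A `\` `I_m) < e%:E.
Proof.
move=> lphi; split.
  move=> A0 e e0; have : submeasure_norm phi A < e%:E by rewrite A0 lte_fin.
  move=> /ereal_inf_lt[_ [F /finite_set_nat_bounded[m Fm] <-] Fe].
  exists m; apply: le_lt_trans Fe; apply: (lscsm_mono lphi) => i [Ai im].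
  by split=> // /Fm.
move=> H; apply/eqP; rewrite eq_le; apply/andP; split.
  apply/lee_addgt0Pr => e e0; rewrite add0e; have [m mP] := H _ e0.
  apply: le_trans (ltW mP); apply: ereal_inf_lbound; exists `I_m => //.
  exact: finite_II.
by apply/ereal_infP => _ [F _ <-]; exact: lscsm_ge0.
Qed.

Lemma half_expn_lt (R : realType) (e : R) : (0 < e)%R ->
  exists n, (2^-1 ^+ n < e)%R.
Proof.
move=> e0; exists (Num.truncn e^-1); rewrite exprVn invf_plt ?posrE ?exprn_gt0//.
apply: lt_le_trans (truncnS_gt _) _; rewrite -natrX ler_nat; exact: ltn_expl.
Qed.

(** Solecki's theorem. *)
Theorem analytic_P_ideal_Exh (R : realType) (I : set (set nat)) :
  is_analytic_P_ideal I -> exists phi : set nat -> \bar R,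
    lscsm phi /\ I = Exh phi.
Proof.
move=> [PI [aI|[f [fc fI]]]].
  suff : [set x : cantor_space | I [set n | x n]] (fun=> false) by rewrite aI.
  by apply: (ideal_finite PI.1); rewrite (_ : mkset _ = set0)//; apply/seteqP; split.
pose g (a : nat -> nat) : set nat := [set n | f a n].
have gI A : I A <-> exists a, g a = A.
  split=> [IA|[a <-]].
    suff : range f (fun n => `[< A n >]).
      move=> [a _ fa]; exists a; apply/seteqP; rewrite /g.
      by split=> n /=; rewrite fa => /asboolP.
    rewrite fI /=; suff -> : [set n | `[< A n >]] = A by [].
    by apply/seteqP; split=> n /= /asboolP.
  have fa : range f (f a) by exists a.
  by rewrite fI in fa.
have gcont a k : exists n, forall b,
    (forall i, (i < n)%N -> b i = a i) -> g b `&` `I_k = g a `&` `I_k.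
  have [n nP] := continuous_baire_cantor fc a k; exists n => b /nP ba.
  by apply/seteqP; split=> i [fi ik]; split=> //; move: fi; rewrite /g /= ba.
have [K [K0 Ks Kc KU KI]] := P_ideal_filtration PI gI gcont.
have Kset0 n : K n set0.
  have /KI/(_ n)[m] : I set0 by exact: (ideal_finite PI.1 (finite_set0 _)).
  by rewrite set0D.
have lm := lscsm_metrization R K0.
exists (metrization R K); split=> //; apply/seteqP; split=> A.
  move=> IA; apply/(ExhP _ lm) => e /half_expn_lt[n ne].
  have [m mP] := (KI A).1 IA n; exists m.
  by apply: le_lt_trans (metrization_le R Ks mP) _; rewrite lte_fin.
move=> /(ExhP _ lm) H; apply/KI => n.
have [|m mP] := H (2^-1 ^+ n)%R; first by rewrite exprn_gt0.
by exists m; apply: metrization_lt mP.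
Qed.

(** * Submeasures, suprema and inclusions between exhaustive ideals *)

(** A bound on the initial segments of [A] is a bound on [A]. *)
Lemma lscsm_le (R : realType) (phi : set nat -> \bar R) A c : lscsm phi ->
  (forall k, phi (A `&` `I_k) <= c) -> phi A <= c.
Proof.
move=> lphi H; apply: (cvge_to_le (@lscsm_lsc _ _ lphi A)).
by apply: nearW => k; exact: H.
Qed.

(** For a monotone set function, the converse of [lscsm_le]. *)
Lemma lsc_of_le (R : realType) (phi : set nat -> \bar R) :
  (forall A B, A `<=` B -> phi A <= phi B) ->
  (forall A c, (forall k, phi (A `&` `I_k) <= c) -> phi A <= c) ->
  forall A, phi (A `&` `I_n) @[n --> \oo] --> phi A.
Proof.
move=> mono H A.
rewrite (_ : phi A = ereal_sup (range (fun n => phi (A `&` `I_n)))).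
  apply: ereal_nondecreasing_cvgn => m n mn; apply: mono.
  by apply: setIS => i /= im; exact: leq_trans im mn.
apply/eqP; rewrite eq_le; apply/andP; split.
  by apply: H => k; apply: ereal_sup_ubound; exists k.
by apply/ereal_supP => _ [k _ <-]; apply: mono; exact: subIsetl.
Qed.

Lemma lscsm_null (R : realType) (mu : set nat -> \bar R) A : lscsm mu ->
  (forall i, A i -> mu [set i] = 0) -> mu A = 0.
Proof.
move=> lmu A0; apply/eqP; rewrite eq_le lscsm_ge0// andbT.
apply: lscsm_le => //; elim=> [|k IH].
  by rewrite II0 setI0 lscsm_set0.
have [Ak|nAk] := pselect (A k); last first.
  apply: le_trans IH; apply: lscsm_mono => // i [Ai /=]; rewrite ltnS leq_eqVlt.
  by move=> /orP[/eqP ik|//]; case: nAk; rewrite -ik.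
have AU : A `&` `I_k.+1 `<=` (A `&` `I_k) `|` [set k].
  move=> i [Ai /=]; rewrite ltnS leq_eqVlt.
  by move=> /orP[/eqP ->|ik]; [right|left].
apply: le_trans (lscsm_mono lmu AU) _; apply: le_trans (lscsm_subadd lmu _ _) _.
by rewrite A0// adde0.
Qed.

Lemma lscsm_supp_le (R : realType) (mu : set nat -> \bar R) A B : lscsm mu ->
  A `&` supp mu `<=` B -> mu A <= mu B.
Proof.
move=> lmu AB; have AU : A `<=` B `|` (A `\` supp mu).
  by move=> i Ai; have [si|nsi] := pselect (supp mu i); [left; apply: AB|right].
apply: le_trans (lscsm_mono lmu AU) _; apply: le_trans (lscsm_subadd lmu _ _) _.
by rewrite (@lscsm_null _ mu (_ `\` _))// ?adde0// => i [_ /contrapT].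
Qed.

Lemma lscsm_restr (R : realType) (phi : set nat -> \bar R) (B : set nat) :
  lscsm phi -> lscsm (fun A => phi (A `&` B)).
Proof.
move=> lphi; split.
- by move=> A; exact: lscsm_ge0.
- by move=> A C AC; apply: lscsm_mono => //; exact: setSI.
- by move=> A C; rewrite setIUl; exact: lscsm_subadd.
- by rewrite set0I lscsm_set0.
- move=> n; apply: le_lt_trans (lscsm_fin lphi n).
  by apply: lscsm_mono => //; exact: subIsetl.
- apply: lsc_of_le => [A C AC|A c H]; first by apply: lscsm_mono => //; exact: setSI.
  by apply: lscsm_le => // k; rewrite setIAC.
Qed.

Lemma lscsm_sup (R : realType) (mu : nat -> set nat -> \bar R) :
  (forall n, lscsm (mu n)) -> trivIset setT (fun n => supp (mu n)) ->
  lscsm (fun A => ereal_sup [set mu n A | n in setT]).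
Proof.
move=> lmu tmu.
have ub n A : mu n A <= ereal_sup [set mu n A | n in setT].
  by apply: ereal_sup_ubound; exists n.
have mono A B : A `<=` B -> ereal_sup [set mu n A | n in setT] <=
    ereal_sup [set mu n B | n in setT].
  move=> AB; apply/ereal_supP => _ [n _ <-].
  by apply: le_trans (ub n B); exact: lscsm_mono.
split=> //.
- by move=> A; apply: le_trans (ub 0%N A); exact: lscsm_ge0.
- move=> A B; apply/ereal_supP => _ [n _ <-].
  by apply: le_trans (lscsm_subadd (lmu n) A B) _; exact: leeD.
- apply/eqP; rewrite eq_le; apply/andP; split.
    by apply/ereal_supP => _ [n _ <-]; rewrite lscsm_set0.
  by apply: le_trans (ub 0%N _); exact: lscsm_ge0.
- move=> i; have [[n ni]|H] := pselect (exists n, supp (mu n) i).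
    apply: le_lt_trans (lscsm_fin (lmu n) i); apply/ereal_supP => _ [m _ <-].
    have [<-//|mn] := eqVneq m n.
    suff -> : mu m [set i] = 0 by exact: lscsm_ge0.
    apply: contrapT => mi; move/eqP: mn; apply.
    by apply: tmu => //; exists i.
  apply: le_lt_trans (ltry 0); apply/ereal_supP => _ [m _ <-].
  suff -> : mu m [set i] = 0 by [].
  by apply: contrapT => mi; apply: H; exists m.
- apply: lsc_of_le => // A c H; apply/ereal_supP => _ [n _ <-].
  by apply: lscsm_le => // k; apply: le_trans (H k).
Qed.

Lemma lscsm_geometric_union (R : realType) (psi : set nat -> \bar R)
    (A : nat -> set nat) k m : lscsm psi ->
  (forall n, psi (A n) <= (2^-1 ^+ n)%:E) ->
  psi (\bigcup_(n in [set n | (m <= n < m + k)%N]) A n) <= (2^-1 ^+ m * 2)%:E.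
Proof.
move=> lpsi H; elim: k m => [|k IH] m.
  rewrite (_ : [set _ | _] = set0); last first.
    apply/seteqP; split=> // n /= /andP[mn]; by rewrite addn0 ltnNge mn.
  by rewrite bigcup_set0 lscsm_set0// lee_fin mulr_ge0// exprn_ge0.
have AU : \bigcup_(n in [set n | (m <= n < m + k.+1)%N]) A n `<=`
    A m `|` \bigcup_(n in [set n | (m.+1 <= n < m.+1 + k)%N]) A n.
  move=> i [n /= /andP[+ nk] Ani]; rewrite leq_eqVlt => /orP[/eqP mn|mn].
    by left; rewrite mn.
  by right; exists n => //=; rewrite mn addSnnS.
apply: le_trans (lscsm_mono lpsi AU) _; apply: le_trans (lscsm_subadd lpsi _ _) _.
apply: le_trans (leeD (H m) (IH m.+1)) _.
rewrite -EFinD lee_fin exprS; lra.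
Qed.

(** Inclusion of exhaustive ideals is an absolute continuity property. If it
fails, there are successive finite sets [A n] with [psi (A n)] summable and
[phi (A n)] bounded below, and their union separates the two ideals. *)
Lemma Exh_sub_continuous (R : realType) (phi psi : set nat -> \bar R) :
  lscsm phi -> lscsm psi -> Exh psi `<=` Exh phi ->
  forall e : R, (0 < e)%R -> exists (d : R) (N : nat), (0 < d)%R /\
    forall A, psi A < d%:E -> phi (A `\` `I_N) < e%:E.
Proof.
move=> lphi lpsi sub e e0; apply: contrapT => H.
have step (n N : nat) : True -> exists N', True /\ (N < N')%N /\ exists A,
    [/\ psi A <= (2^-1 ^+ n)%:E, (e / 2)%:E < phi A &
        A `<=` [set i | (N <= i < N')%N]].
  move=> _; have [A [An Ae]] : exists A, psi A < (2^-1 ^+ n)%:E /\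
      e%:E <= phi (A `\` `I_N).
    apply: contrapT => H'; apply: H; exists (2^-1 ^+ n)%R, N.
    split; first by rewrite exprn_gt0.
    by move=> A An; rewrite ltNge; apply/negP => ?; apply: H'; exists A.
  have [k ke] : exists k, (e / 2)%:E < phi ((A `\` `I_N) `&` `I_k).
    apply: contrapT => H'.
    have : phi (A `\` `I_N) <= (e / 2)%:E.
      apply: lscsm_le => // k; rewrite leNgt; apply/negP => ke.
      by apply: H'; exists k.
    move=> /(le_trans Ae); rewrite lee_fin; lra.
  exists (maxn N.+1 k); split=> //; split; first by rewrite leq_maxl.
  exists ((A `\` `I_N) `&` `I_k); split=> //.
    by apply: le_trans (ltW An); apply: lscsm_mono => // i [[]].
  move=> i [[Ai /negP]] /=; rewrite -leqNgt => -> ik /=.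
  by rewrite leq_max ik orbT.
have [N [N0 NP]] := @dep_choice _ (fun=> True) _ 0%N Logic.I step.
have /choice[A AP] n := (NP n).2.2.
have Nmono : {homo N : m n / (m <= n)%N}.
  by apply: homo_leq => // [x y z|n]; [exact: leq_trans|exact: ltnW (NP n).2.1].
have Nge n : (n <= N n)%N.
  by elim: n => // n IH; exact: leq_ltn_trans IH (NP n).2.1.
have : Exh psi (\bigcup_n A n).
  apply/ExhP => // d d0; have [|m mP] := half_expn_lt (e := d / 2).
    by rewrite divr_gt0.
  exists (N m); apply: (@le_lt_trans _ _ (2^-1 ^+ m * 2)%:E); last first.
    by rewrite lte_fin; lra.
  apply: lscsm_le => // k.
  have An n : psi (A n) <= (2^-1 ^+ n)%:E by have [] := AP n.
  apply: le_trans (lscsm_geometric_union k m lpsi An).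
  apply: lscsm_mono => // i [[[n _ Ani] /negP]] /=; rewrite -leqNgt => im ik.
  have [_ _ /(_ i Ani) /= /andP[ni iN]] := AP n.
  exists n => //=; apply/andP; split.
    rewrite leqNgt; apply/negP => /Nmono/leq_trans-/(_ _ im).
    by rewrite leqNgt iN.
  apply: leq_trans (leq_addl _ _); apply: leq_ltn_trans ik.
  exact: leq_trans (Nge n) ni.
move=> /sub/(ExhP _ lphi)/(_ (e / 2)%R)[|m]; first by rewrite divr_gt0.
apply/negP; rewrite -leNgt; have [_ /ltW mA AN] := AP m.
apply: le_trans mA _; apply: lscsm_mono => // i Ai; split; first by exists m.
have /andP[+ _] := AN i Ai => /(leq_trans (Nge m)) mi.
by apply/negP; rewrite -leqNgt.
Qed.

(** * Generalized density ideals and the two separation conditions *)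

Lemma strictly_increasing_step (s : nat -> nat) :
  (forall n, (s n < s n.+1)%N) -> strictly_increasing s.
Proof. by move=> H; apply: homo_ltn => // x y z; exact: ltn_trans. Qed.

Lemma strictly_increasing_ge (s : nat -> nat) n :
  strictly_increasing s -> (n <= s n)%N.
Proof.
by move=> si; elim: n => // n IH; apply: leq_ltn_trans IH (si _ _ _).
Qed.

Lemma strictly_increasing_lt (s : nat -> nat) m n :
  strictly_increasing s -> (s m < s n)%N -> (m < n)%N.
Proof.
move=> si; rewrite !ltnNge; apply: contra; rewrite leq_eqVlt.
by move=> /orP[/eqP ->//|/si/ltnW].
Qed.

Lemma fset_max_ge (A : {fset nat}) i : i \in A -> (i <= fset_max A)%N.
Proof. by move=> iA; apply: leq_bigmax_seq. Qed.

Lemma fset_max_lt (A : {fset nat}) c : A <> fset0 ->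
  (forall i, i \in A -> (i < c)%N) -> (fset_max A < c)%N.
Proof.
move=> /eqP/fset0Pn[x xA] H; case: c H => [/(_ _ xA)//|c H].
by rewrite ltnS; apply/bigmax_leqP_seq => i iA _; exact: H.
Qed.

Lemma fset_min_le (A : {fset nat}) i : i \in A -> (fset_min A <= i)%N.
Proof.
rewrite /fset_min -[i \in A]/(i \in enum_fset A).
elim: (enum_fset A) => // x s IH; rewrite inE big_cons => /orP[/eqP <-|/IH].
  exact: geq_minl.
by apply: leq_trans; exact: geq_minr.
Qed.

Lemma fset_min_ge (A : {fset nat}) c : A <> fset0 ->
  (forall i, i \in A -> (c <= i)%N) -> (c <= fset_min A)%N.
Proof.
move=> /eqP/fset0Pn[x xA] H; rewrite /fset_min big_seq.
apply: (big_ind (fun i => (c <= i)%N)) => //.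
- exact: leq_trans (H _ xA) (fset_max_ge xA).
- by move=> i j ci cj; rewrite leq_min ci.
Qed.

Lemma fset_min_le_max (A : {fset nat}) : A <> fset0 ->
  (fset_min A <= fset_max A)%N.
Proof.
by move=> /eqP/fset0Pn[x xA]; exact: leq_trans (fset_min_le xA) (fset_max_ge xA).
Qed.

Lemma F_incr_max_lt_min (F : nat -> {fset nat}) m n : F_incr F -> (m < n)%N ->
  (fset_max (F m) < fset_min (F n))%N.
Proof.
move=> [F0 FF]; elim: n => // n IH; rewrite ltnS leq_eqVlt => /orP[/eqP ->//|/IH mn].
by apply: ltn_trans mn (leq_ltn_trans _ (FF n)); exact: fset_min_le_max.
Qed.

Lemma F_incr_min_le (F : nat -> {fset nat}) m n : F_incr F -> (m <= n)%N ->
  (fset_min (F m) <= fset_min (F n))%N.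
Proof.
move=> FI; rewrite leq_eqVlt => /orP[/eqP ->//|mn].
apply: ltnW; apply: leq_ltn_trans (F_incr_max_lt_min FI mn).
by apply: fset_min_le_max; exact: FI.1.
Qed.

Lemma F_incr_ge (F : nat -> {fset nat}) n i : F_incr F -> i \in F n ->
  (n <= i)%N.
Proof.
move=> FI iF; apply: leq_trans (fset_min_le iF) => {i iF}.
elim: n => // n IH; apply: leq_ltn_trans IH _.
by apply: leq_ltn_trans (FI.2 n); apply: fset_min_le_max; exact: FI.1.
Qed.

(** Finite disjoint sets that have an element below [j] are uniformly bounded. *)
Lemma supports_finitely_overlapping (S : nat -> set nat) (j : nat) :
  (forall n, finite_set (S n)) -> trivIset setT S ->
  exists j', forall n i i', (i < j)%N -> S n i -> S n i' -> (i' <= j')%N.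
Proof.
move=> Sfin tS; elim: j => [|j [j1 IH]]; first by exists 0%N.
have [[m mj]|none] := pselect (exists m, S m j).
  have [j2 Sj2] := finite_set_nat_bounded (Sfin m); exists (maxn j1 j2).
  move=> n i i'; rewrite ltnS leq_eqVlt leq_max => /orP[/eqP ->|ij] ni ni'.
    have nm : n = m by apply: tS => //; exists j.
    by rewrite nm in ni'; rewrite (ltnW (Sj2 _ ni')) orbT.
  by rewrite (IH n i i').
exists j1 => n i i'; rewrite ltnS leq_eqVlt => /orP[/eqP -> nj|]; last exact: IH.
by case: none; exists n.
Qed.

(** One sequence [s], depending only on the supports, serves every submeasure
[phi] that represents the ideal. *)
Lemma generalized_density_D_strong (R : realType)
    (mu : nat -> set nat -> \bar R) (phi : set nat -> \bar R) :
  (forall n, lscsm (mu n)) -> (forall n, finite_set (supp (mu n))) ->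
  trivIset setT (fun n => supp (mu n)) -> lscsm phi ->
  Exh phi = Exh (fun A => ereal_sup [set mu n A | n in setT]) ->
  D_strong phi.
Proof.
move=> lmu fmu tmu lphi; set psi := (fun A => _) => E.
have lpsi : lscsm psi by exact: lscsm_sup.
have mu_psi n A : mu n A <= psi A by apply: ereal_sup_ubound; exists n.
have step (n x : nat) : True -> exists y, True /\ ((x < y)%N /\
    forall j i i', (i <= x)%N -> supp (mu j) i -> supp (mu j) i' -> (i' <= y)%N).
  move=> _; have [y yP] := supports_finitely_overlapping x.+1 fmu tmu.
  exists (maxn x.+1 y); split=> //; split; first by rewrite leq_maxl.
  by move=> j i i' ix ji /(yP _ _ _ ix ji) iy; rewrite leq_max iy orbT.
have [s [_ sP]] := @dep_choice _ (fun=> True) _ 0%N Logic.I step.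
have si : strictly_increasing s.
  by apply: strictly_increasing_step => n; have [_ []] := sP n.
exists s; split=> // e e0; have e20 : (0 < e / 2)%R by rewrite divr_gt0.
have [d1 [N1 [d10 psi_phi]]] : exists (d : R) (N : nat), (0 < d)%R /\
    forall A, psi A < d%:E -> phi (A `\` `I_N) < (e / 2)%:E.
  by apply: Exh_sub_continuous => //; rewrite E.
have [d2 [N2 [d20 phi_psi]]] : exists (d : R) (N : nat), (0 < d)%R /\
    forall A, phi A < d%:E -> psi (A `\` `I_N) < (d1 / 3)%:E.
  by apply: Exh_sub_continuous => //; rewrite ?E// divr_gt0.
pose N := maxn N1 N2; pose d3 : R := (e / 2 / N.+1%:R)%R.
have d30 : (0 < d3)%R by rewrite divr_gt0.
exists (Num.min d2 d3); split; first by rewrite lt_min d20.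
move=> F k FI Fd [ki sk]; set B := \bigcup_n _.
have F2 n : phi [set` F n] < d2%:E.
  by apply: lt_le_trans (Fd n) _; rewrite lee_fin ge_min lexx.
have F3 n : phi [set` F n] < d3%:E.
  by apply: lt_le_trans (Fd n) _; rewrite lee_fin ge_min lexx orbT.
(* Below [N] there are at most [N] of the sets [F (k n)]. *)
have small : phi (B `&` `I_N) <= (e / 2)%:E.
  suff H M : phi (\bigcup_(n in `I_M) [set` F (k n)]) <= (d3 * M%:R)%:E.
    apply: (@le_trans _ _ (phi (\bigcup_(n in `I_N) [set` F (k n)]))).
      apply: lscsm_mono => // i [[n _ Fi] iN]; exists n => //=.
      apply: leq_ltn_trans iN; apply: leq_trans (F_incr_ge FI Fi).
      exact: strictly_increasing_ge.
    apply: le_trans (H N) _; rewrite lee_fin /d3 mulrAC ler_pdivrMr//.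
    by apply: ler_wpM2l; [exact: ltW|rewrite ler_nat].
  elim: M => [|M IH]; first by rewrite II0 bigcup_set0 lscsm_set0// mulr0.
  have U : \bigcup_(n in `I_M.+1) [set` F (k n)] `<=`
      \bigcup_(n in `I_M) [set` F (k n)] `|` [set` F (k M)].
    move=> i [n /=]; rewrite ltnS leq_eqVlt => /orP[/eqP ->|nM] Fi; first by right.
    by left; exists n.
  apply: le_trans (lscsm_mono lphi U) _; apply: le_trans (lscsm_subadd lphi _ _) _.
  by rewrite -natr1 mulrDr mulr1 EFinD leeD// ltW.
(* Beyond [N], the support of [mu j] meets at most two consecutive [F (k n)]. *)
have big : psi (B `\` `I_N) < d1%:E.
  apply: (@le_lt_trans _ _ (d1 / 3 + d1 / 3)%:E); last by rewrite lte_fin; lra.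
  apply/ereal_supP => _ [j _ <-].
  have Fpsi n : mu j ([set` F n] `\` `I_N) <= (d1 / 3)%:E.
    apply: le_trans (mu_psi _ _) _; apply: le_trans _ (ltW (phi_psi _ (F2 n))).
    by apply: lscsm_mono => //; apply: setD_II_le; rewrite leq_maxr.
  have [exn|none] := pselect (exists n, `[< exists2 i,
      i \in F (k n) & supp (mu j) i >]); last first.
    apply: (@le_trans _ _ (mu j set0)).
      apply: lscsm_supp_le => // i [[[n _ Fi] _] ji]; apply: none; exists n.
      by apply/asboolP; exists i.
    by rewrite lscsm_set0// lee_fin; lra.
  case: (ex_minnP exn) => n /asboolP[i iF ji] nmin.
  apply: (@le_trans _ _ (mu j (([set` F (k n)] `\` `I_N) `|`
      ([set` F (k n.+1)] `\` `I_N)))); last first.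
    by apply: le_trans (lscsm_subadd (lmu j) _ _) _; rewrite EFinD; exact: leeD.
  apply: lscsm_supp_le => // i' [[[n' _ Fi'] i'N] ji'].
  have nn' : (n <= n')%N by apply: nmin; apply/asboolP; exists i'.
  move: nn'; rewrite leq_eqVlt => /orP[/eqP ->|]; first by left.
  rewrite leq_eqVlt => /orP[/eqP ->|nn']; first by right.
  exfalso.
  have [m /andP[nm mn]] := sk n; have [m' /andP[nm' mn']] := sk n.+1.
  have mm' : (m < m')%N.
    apply: (strictly_increasing_lt si); apply: leq_trans mn _.
    by apply: leq_trans nm'; apply: fset_min_le_max; exact: FI.1.
  have i'm' : (s m' < i')%N.
    apply: leq_trans mn' _; apply: leq_trans (fset_min_le Fi').
    by apply: F_incr_min_le => //; move: nn'; rewrite leq_eqVlt => /orP[/eqP ->//|/ki/ltnW].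
  have [_ [_ sjm]] := sP m.
  have := sjm j i i' (leq_trans (fset_max_ge iF) nm) ji ji'.
  rewrite leqNgt => /negP; apply; apply: leq_ltn_trans i'm'.
  by move: mm'; rewrite leq_eqVlt => /orP[/eqP ->//|/si/ltnW].
apply: (@le_lt_trans _ _ (phi ((B `&` `I_N) `|` (B `\` `I_N)))).
  by apply: lscsm_mono => // i Bi; have [iN|iN] := pselect (`I_N i); [left|right].
apply: le_lt_trans (lscsm_subadd lphi _ _) _.
rewrite (_ : e%:E = (e / 2)%:E + (e / 2)%:E); last by rewrite -EFinD; congr EFin; lra.
apply: lee_ltD => //.
  by rewrite ge0_fin_numE ?lscsm_ge0//; exact: le_lt_trans small (ltry _).
apply: le_lt_trans (psi_phi _ big); apply: lscsm_mono => // i [Bi iN].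
by split=> // /= iN1; apply: iN => /=; apply: leq_trans iN1 _; rewrite leq_maxl.
Qed.

(** The increasing enumeration of an unbounded set. *)
Lemma unbounded_enumeration (Z : set nat) :
  (forall n, exists m, (n <= m)%N /\ Z m) ->
  exists z : nat -> nat, [/\ strictly_increasing z, forall i, Z (z i) &
    forall n, Z n -> exists i, z i = n].
Proof.
move=> unb.
have next n : exists m, [/\ (n <= m)%N, Z m & forall p, (n <= p)%N -> Z p -> (m <= p)%N].
  have exm : exists m, (n <= m)%N && `[< Z m >].
    by have [m [nm Zm]] := unb n; exists m; rewrite nm; exact/asboolP.
  case: (ex_minnP exm) => m /andP[nm /asboolP Zm] mmin; exists m; split=> // p np Zp.
  by apply: mmin; rewrite np; exact/asboolP.
have step (n x : nat) : Z x -> exists y, Z y /\ ((x < y)%N /\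
    forall p, (x < p)%N -> Z p -> (y <= p)%N).
  by move=> _; have [y [xy Zy ymin]] := next x.+1; exists y.
have [z0 [_ Zz0 z0min]] := next 0%N.
have [z [z0E zP]] := dep_choice Zz0 step.
have zi : strictly_increasing z.
  by apply: strictly_increasing_step => i; have [_ []] := zP i.
exists z; split=> //; first by move=> i; have [] := zP i.
move=> n Zn; have exi : exists i, (n < z i.+1)%N.
  by exists n; exact: strictly_increasing_ge.
case: (ex_minnP exi) => i ni imin; exists i; apply/eqP; rewrite eqn_leq.
have zin : (z i <= n)%N.
  case: i ni imin => [|i] _ imin; first by rewrite z0E z0min.
  by rewrite leqNgt; apply/negP => /imin; rewrite ltnn.
rewrite zin /= leqNgt; apply/negP => lt.
by have [_ [_ /(_ n lt Zn)]] := zP i; rewrite leqNgt ni.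
Qed.

(** The bound of the weak condition, for the union of a sequence of possibly
empty finite sets [G n] separated by points of [s]. *)
Lemma D_weak_separated_union (R : realType) (phi : set nat -> \bar R)
    (s : nat -> nat) (d e : R) (G : nat -> set nat) :
  lscsm phi -> (0 < e)%R ->
  (forall F k, F_incr F -> (forall n, phi [set` F n] < d%:E) ->
    K s F k -> phi (\bigcup_n [set` F (k n)]) < e%:E) ->
  (forall n, exists m, (forall x, G n x -> (x <= s m)%N) /\
    forall n' y, (n < n')%N -> G n' y -> (s m < y)%N) ->
  (forall n, phi (G n) < d%:E) ->
  exists m, phi ((\bigcup_n G n) `\` `I_m) < e%:E.
Proof.
move=> lphi e0 HF sep Gd.
have Gfin n : finite_set (G n).
  have [m [Gm _]] := sep n; apply: (@bounded_finite_set _ (s m).+1) => x /Gm.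
  by rewrite /= ltnS.
(* If infinitely many [G n] are nonempty, these form a sequence [F] to which the
   hypothesis applies with [k] the identity; otherwise the union is finite. *)
have [unb|/existsNP[n Hn]] := pselect (forall n, exists m, (n <= m)%N /\ G m !=set0).
  have [z [zi Zz zZ]] := unbounded_enumeration unb.
  pose F i := fset_set (G (z i)).
  have FE i : [set` F i] = G (z i) by exact: fset_setK.
  have Fin i x : x \in F i -> G (z i) x by rewrite -FE.
  have F0 i : F i <> fset0.
    by have [x xG] := Zz i => Fi; move: xG; rewrite -FE Fi.
  have FK i : exists m, (fset_max (F i) <= s m < fset_min (F i.+1))%N.
    have [m [ltm gtm]] := sep (z i); exists m; rewrite -ltnS fset_max_lt//=.
      by apply: fset_min_ge => // x /Fin; apply: gtm; exact: zi.
    by move=> x /Fin /ltm; rewrite ltnS.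
  exists 0%N; apply: le_lt_trans (HF F id _ _ _).
  - apply: lscsm_mono => // x [[n _ nx] _].
    have [i zin] : exists i, z i = n by apply: zZ; exists x.
    by exists i; rewrite // FE zin.
  - split=> // i; have [m /andP[ltm gtm]] := FK i.
    exact: leq_ltn_trans ltm gtm.
  - by move=> i; rewrite FE.
  - by split=> // m n.
have [m Gm] : exists m, \bigcup_(i in `I_n) G i `<=` `I_m.
  apply: finite_set_nat_bounded; apply: bigcup_finite => //; exact: finite_II.
exists m; rewrite (_ : _ `\` _ = set0) ?lscsm_set0//.
apply/seteqP; split=> // x [[i _ ix]]; apply.
apply: Gm; exists i => //=; rewrite ltnNge; apply/negP => ni.
by apply: Hn; exists i; split=> //; exists x.
Qed.

(** The [mu n] are the restrictions of [phi] to successive intervals. *)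
Lemma D_weak_generalized_density (R : realType) (phi : set nat -> \bar R) :
  lscsm phi -> D_weak phi -> generalized_density_ideal R (Exh phi).
Proof.
move=> lphi Dw.
have /choice[ds dsP] (j : nat) : exists ds : R * (nat -> nat),
    [/\ (0 < ds.1)%R, strictly_increasing ds.2 &
      forall F k, F_incr F -> (forall n, phi [set` F n] < ds.1%:E) ->
        K ds.2 F k -> phi (\bigcup_n [set` F (k n)]) < (2^-1 ^+ j)%:E].
  have [|d [s [d0 si H]]] := Dw (2^-1 ^+ j)%R; first by rewrite exprn_gt0.
  by exists (d, s).
have step (n x : nat) : True -> exists y, True /\ ((x < y)%N /\
    forall j, (j <= n)%N -> ((ds j).2 x < y)%N).
  move=> _; elim: n => [|n [y [_ [xy IH]]]].
    exists (maxn x ((ds 0%N).2 x)).+1; split=> //; split; first by rewrite ltnS leq_maxl.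
    by move=> j; rewrite leqn0 => /eqP ->; rewrite ltnS leq_maxr.
  exists (maxn y ((ds n.+1).2 x).+1); split=> //; split.
    by apply: leq_trans xy _; rewrite leq_maxl.
  move=> j; rewrite leq_eqVlt => /orP[/eqP ->|]; first by rewrite leq_maxr.
  by move=> /IH jy; apply: leq_trans jy _; rewrite leq_maxl.
have [t [t0 tP]] := @dep_choice _ (fun=> True) _ 0%N Logic.I step.
have ti : strictly_increasing t.
  by apply: strictly_increasing_step => n; have [_ []] := tP n.
have ts n j : (j <= n)%N -> ((ds j).2 (t n) < t n.+1)%N.
  by have [_ [_]] := tP n; exact.
pose J n := [set i | (t n <= i < t n.+1)%N].
pose mu n A := phi (A `&` J n).
have lmu n : lscsm (mu n) by exact: lscsm_restr.
have suppJ n : supp (mu n) `<=` J n.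
  move=> i; rewrite /supp /mu /= => ni; apply: contrapT => nJ; apply: ni.
  rewrite (_ : _ `&` _ = set0) ?lscsm_set0//.
  by apply/seteqP; split=> // x [/= ->].
have Jdisj m n i : J m i -> J n i -> m = n.
  suff H p q : J p i -> J q i -> (p <= q)%N.
    by move=> mi ni; apply/eqP; rewrite eqn_leq !H.
  move=> /andP[pi _] /andP[_ iq]; rewrite -ltnS.
  by apply: (strictly_increasing_lt ti); exact: leq_ltn_trans pi iq.
have tmu : trivIset setT (fun n => supp (mu n)).
  by move=> m n _ _ [i [/suppJ mi /suppJ ni]]; exact: Jdisj mi ni.
have lpsi := lscsm_sup lmu tmu.
set psi := (fun A => ereal_sup _) in lpsi.
exists mu; split=> //.
  move=> n; apply: (@bounded_finite_set _ (t n.+1)) => i /suppJ /andP[]//.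
rewrite -/psi; apply/seteqP; split=> A.
  move=> /(ExhP _ lphi) H; apply/(ExhP _ lpsi) => e /H[m me]; exists m.
  apply: le_lt_trans me; apply/ereal_supP => _ [n _ <-].
  by apply: lscsm_mono => //; exact: subIsetl.
move=> /(ExhP _ lpsi) H; apply/(ExhP _ lphi) => e e0.
have [|j je] := half_expn_lt (e := e / 2); first by rewrite divr_gt0.
have [dj0 sji Hj] := dsP j; set d := (ds j).1 in dj0 Hj *.
set s := (ds j).2 in sji Hj *.
have [M0 M0d] := H _ dj0; pose M := maxn M0 j.
(* [b] is the parity: the intervals [J (M + b + n.*2)] are pairwise separated by
   the intervals between them, each of which contains a point of [s]. *)
have half b : exists m, phi
    ((\bigcup_n (A `&` J (M + b + n.*2)%N)) `\` `I_m) < (2^-1 ^+ j)%:E.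
  apply: (D_weak_separated_union lphi _ Hj); first by rewrite exprn_gt0.
  - move=> n; set q := (M + b + n.*2)%N; exists (t q.+1); split.
      move=> x [_ /andP[_ xq]]; apply: leq_trans (ltnW xq) _.
      exact: strictly_increasing_ge.
    move=> n' y nn' [_ /andP[ty _]]; apply: leq_trans ty.
    apply: leq_trans (ts q.+1 j _) _.
      by rewrite /q -addnA -addnS; apply: leq_trans (leq_addr _ _); rewrite leq_maxr.
    have : (q.+2 <= M + b + n'.*2)%N by rewrite /q -!addnS leq_add2l -doubleS leq_double.
    by rewrite leq_eqVlt => /orP[/eqP <-//|/ti/ltnW].
  move=> n; apply: le_lt_trans M0d.
  apply: (@le_trans _ _ (mu (M + b + n.*2)%N (A `\` `I_M0))).
    apply: (lscsm_mono lphi) => i [Ai Ji]; split=> //; split=> //=.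
    apply/negP; rewrite -leqNgt; have /andP[ti' _] := Ji.
    apply: leq_trans ti'; apply: leq_trans (strictly_increasing_ge _ ti).
    by rewrite -addnA; apply: leq_trans (leq_addr _ _); rewrite leq_maxl.
  by apply: ereal_sup_ubound; exists (M + b + n.*2)%N.
have [m0 m0P] := half 0%N; have [m1 m1P] := half 1%N.
exists (maxn (t M) (maxn m0 m1)).
apply: (@le_lt_trans _ _ (phi (
    ((\bigcup_n (A `&` J (M + 0 + n.*2)%N)) `\` `I_m0) `|`
    ((\bigcup_n (A `&` J (M + 1 + n.*2)%N)) `\` `I_m1)))); last first.
  apply: le_lt_trans (lscsm_subadd lphi _ _) _.
  apply: lt_le_trans (lteD m0P m1P) _; rewrite -EFinD lee_fin; lra.
apply: lscsm_mono => // i [Ai /negP] /=; rewrite -leqNgt !geq_max.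
move=> /andP[Mi /andP[m0i m1i]].
have [q Jq] : exists q, J q i.
  have exi : exists q, (i < t q)%N.
    by exists i.+1; exact: (strictly_increasing_ge _ ti).
  case: (ex_minnP exi) => -[|q] iq qmin; first by rewrite t0 in iq.
  by exists q; rewrite /J /= iq andbT leqNgt; apply/negP => /qmin; rewrite ltnn.
have Mq : (M <= q)%N.
  rewrite -ltnS; apply: (strictly_increasing_lt ti).
  by apply: leq_ltn_trans Mi _; have /andP[] := Jq.
have qE : q = (M + odd (q - M) + (q - M)./2.*2)%N.
  by rewrite -addnA odd_double_half subnKC.
case: (boolP (odd (q - M))) qE => [_|_] qE.
- right; split; last by apply/negP; rewrite -leqNgt.
  by exists (q - M)./2 => //; split=> //; rewrite -qE.
- left; split; last by apply/negP; rewrite -leqNgt.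
  by exists (q - M)./2 => //; split=> //; rewrite -qE.
Qed.

Theorem theorem5p3 (R : realType) (I : set (set nat))
    (hI : is_analytic_P_ideal I) :
  [<-> generalized_density_ideal R I;
       forall phi : set nat -> \bar R, lscsm phi -> I = Exh phi -> D_strong phi;
       forall phi : set nat -> \bar R, lscsm phi -> I = Exh phi -> D_weak phi;
       exists phi : set nat -> \bar R, [/\ lscsm phi, I = Exh phi & D_strong phi];
       exists phi : set nat -> \bar R, [/\ lscsm phi, I = Exh phi & D_weak phi]].
Proof.
have strong_weak (phi : set nat -> \bar R) : D_strong phi -> D_weak phi.
  by move=> [s [si H]] e /H[d [d0 Hd]]; exists d, s.
have density_strong : generalized_density_ideal R I ->
    forall phi : set nat -> \bar R, lscsm phi -> I = Exh phi -> D_strong phi.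
  move=> [mu [lmu fmu tmu EI]] phi lphi EIphi.
  by apply: (generalized_density_D_strong lmu fmu tmu lphi); rewrite -EIphi.
tfae => [|H phi lphi E|H|[phi [lphi E /strong_weak Dw]]|[phi [lphi -> Dw]]].
- exact: density_strong.
- by apply: strong_weak; exact: H.
- have [phi [lphi E]] := analytic_P_ideal_Exh R hI.
  exists phi; split=> //; apply: density_strong => //.
  by rewrite E; apply: D_weak_generalized_density => //; exact: H.
- by exists phi.
- exact: D_weak_generalized_density.
Qed.
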